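(* Let $(\mathcal{S},\mathcal{T},d)$ be a lazy task system such that both $\mathcal{S}$ and $\mathcal{T}$ are finite. Then the online problem $(\mathcal{S},\mathcal{T},d)$ is compact.
   Context: A generalized task system $(\mathcal{S},\mathcal{T},d)$: a set $\mathcal{S}$ of states, a set $\mathcal{T}$ of tasks, each task $t:\mathcal{S}\to\mathbb{R}_{\ge0}\cup\{\infty\}$ having at least one state with $t(s)\neq\infty$, and a function $d:\mathcal{S}\times\mathcal{S}\to\mathbb{R}_{\geq0}$. An input is $(s_0,t_1,\dots,t_n)$ with initial state $s_0$ and tasks $t_i\in\mathcal{T}$; an online algorithm outputs states $s_1,\dots,s_n$, $s_i$ computed from $s_0,t_1,\dots,t_i$, with $t_i(s_i)\neq\infty$, paying $d(s_{i-1},s_i)+t_i(s_i)$ in round $i$; the cost is the sum. It is a lazy task system if additionally $d(s,s')>0$ for $s\neq s'$ and $d(s,s')\leq d(s,s'')+d(s'',s')$ for all states. Competitiveness: a randomized algorithm (probability distribution over deterministic algorithms) $R$ is $c$-competitive if there is a constant $\alpha$ (independent of the input, including $s_0$) with $\mathbb{E}[R(\sigma)]\le c\,\mathrm{OPT}(\sigma)+\alpha$ for all $\sigma$. A minimization problem is compact if, whenever $c>1$ is a constant such that every randomized algorithm has competitive ratio at least $c$, then for every $\varepsilon>0$ and $\alpha\geq0$ there is an input distribution $p_{\alpha,\varepsilon}$ with finite support such that $\mathbb{E}_{p_{\alpha,\varepsilon}}[D(\sigma)]\geq(c-\varepsilon)\mathbb{E}_{p_{\alpha,\varepsilon}}[\mathrm{OPT}(\sigma)]+\alpha$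 for every deterministic algorithm $D$ without advice. *)

(* Defs.v *)
From HB Require Import structures.
From mathcomp Require Import all_boot all_order all_algebra.
From mathcomp Require Import all_classical all_reals all_analysis.
Set Implicit Arguments. Unset Strict Implicit. Unset Printing Implicit Defensive.
Import Order.TTheory GRing.Theory Num.Theory.
Local Open Scope ring_scope.
Local Open Scope classical_set_scope.

Section TaskSystems.
Context (R : realType) (S T : finType) (task : T -> S -> \bar R)
        (d : S -> S -> R).

(* Generalized task system axioms (with T faithfully indexing a SET of
   task functions, hence [task] injective). *)
Definition task_system : Prop :=
  injective task /\
  (forall t s, (0 <= task t s)%E) /\
  (forall t, exists s, task t s != +oo%E) /\
  (forall s s', 0 <= d s s').

Definition lazy_task_system : Prop :=
  task_system /\
  (forall s s', s != s' -> 0 < d s s') /\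
  (forall s s' s'', d s s' <= d s s'' + d s'' s').

Fixpoint path_cost (s : S) (ts : seq T) (ss : seq S) : \bar R :=
  match ts, ss with
  | t :: ts', s' :: ss' => ((d s s')%:E + task t s' + path_cost s' ts' ss')%E
  | _, _ => 0%E
  end.

Definition OPT (s0 : S) (ts : seq T) : \bar R :=
  ereal_inf [set path_cost s0 ts ss | ss in [set ss : seq S | size ss = size ts]].

(* deterministic online algorithm: s_i := D s0 [:: t_1; ...; t_i] *)
Definition det_alg := S -> seq T -> S.

Definition feasible (D : det_alg) : Prop :=
  forall s0 ts t, task t (D s0 (rcons ts t)) != +oo%E.

Definition run (D : det_alg) (s0 : S) (ts : seq T) : seq S :=
  [seq D s0 (take i.+1 ts) | i <- iota 0 (size ts)].

Definition alg_cost (D : det_alg) (s0 : S) (ts : seq T) : \bar R :=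
  path_cost s0 ts (run D s0 ts).

(* randomized algorithm: a random deterministic algorithm on a probability
   space, i.e. a probability distribution on deterministic algorithms
   (w.r.t. the product sigma-algebra generated by the outputs). *)
Definition randomized_alg (dd : measure_display) (Om : measurableType dd)
  (A : Om -> det_alg) : Prop :=
  (forall w, feasible (A w)) /\
  (forall s0 ts s, measurable [set w | A w s0 ts = s]).

Definition rand_competitive (dd : measure_display) (Om : measurableType dd)
  (P : probability Om R) (A : Om -> det_alg) (c : R) : Prop :=
  exists alpha : R, forall s0 ts,
    (\int[P]_w alg_cost (A w) s0 ts <= c%:E * OPT s0 ts + alpha%:E)%E.

Definition input_dist (p : seq ((S * seq T) * R)) : Prop :=
  (forall x, x \in p -> 0 <= x.2) /\ \sum_(x <- p) x.2 = 1.

Definition expect (p : seq ((S * seq T) * R)) (f : S -> seq T -> \bar R)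
  : \bar R := (\sum_(x <- p) ((x.2)%:E * f x.1.1 x.1.2))%E.

Definition compact_problem : Prop :=
  forall c : R, 1 < c ->
  (forall (dd : measure_display) (Om : measurableType dd)
          (P : probability Om R) (A : Om -> det_alg),
      randomized_alg A -> forall c' : R, c' < c -> ~ rand_competitive P A c') ->
  forall eps alpha : R, 0 < eps -> 0 <= alpha ->
  exists p, input_dist p /\
    forall D : det_alg, feasible D ->
      ((c - eps)%:E * expect p OPT + alpha%:E <= expect p (alg_cost D))%E.

End TaskSystems.

(* Main.v *)
Require Import Defs.
From HB Require Import structures.
From mathcomp Require Import all_boot all_order all_algebra.
From mathcomp Require Import all_classical all_reals all_analysis.
From mathcomp Require Import measurable_realfun.
From mathcomp Require Import ring lra.
Import Order.TTheory GRing.Theory Num.Theory numFieldNormedType.Exports.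

(** Suppose some [eps] and [alpha] admit no hard input distribution: every
    finitely supported distribution has a feasible deterministic best response
    [D] with [E[D] < (c - eps) E[OPT] + alpha].  On the first [n] inputs,
    playing best responses against the current positive regrets (Blackwell
    approachability) keeps the sum of squared regrets linear in the number of
    plays, so a long enough play, drawn uniformly, is a randomized algorithm
    with expected cost at most [(c - eps) OPT + alpha + 1] on all of these
    inputs.  Since there are finitely many states, the laws of these algorithms
    converge along an ultrafilter on every cylinder (finitely many prescribed
    outputs).  The limit masses are realized on [[0, 1)] with Lebesgue measure
    by nested intervals; the cost on a fixed input depends on finitely many
    outputs, so the bound survives in the limit and contradicts the assumed
    lower bound [c]. *)

(** * Regret matching in a game with finitely many inputs *)

Section FiniteGame.
Set Implicit Arguments.
Unset Strict Implicit.
Local Open Scope ring_scope.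
Context (R : realType) (J : Type) (X : eqType) (I : seq X).
Variables (g : J -> X -> R) (B : X -> R).
Hypothesis g_bound : forall j x, `|g j x| <= B x.
Hypothesis response : forall w : X -> R, (forall x, 0 <= w x) ->
  exists j, \sum_(x <- I) w x * g j x <= 0.

Let excess (L : seq J) x := Num.max 0 (\sum_(j <- L) g j x).

(** Truncating at zero before adding [g j x] instead of after cannot decrease the square; expanding
    that square gives the bound. *)
Lemma excess_sqr_cons j L x :
  excess (j :: L) x ^+ 2 <= excess L x ^+ 2 + 2 * (excess L x * g j x) + B x ^+ 2.
Proof.
rewrite /excess big_cons; move: (\sum_(j <- L) g j x) (g_bound j x) => a.
rewrite ler_norml => /andP[b1 b2].
have h : g j x ^+ 2 <= B x ^+ 2 by nra.
case: (lerP 0 a) => ha; case: (lerP 0 (g j x + a)) => hb; nra.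
Qed.

(** Taking the current excesses as weights, the response makes the summed cross term nonpositive, so
    each play adds at most the sum of [B x ^+ 2]. *)
Lemma slow_excess_growth t : exists L : seq J, size L = t /\
  \sum_(x <- I) excess L x ^+ 2 <= t%:R * \sum_(x <- I) B x ^+ 2.
Proof.
elim: t => [|t [L [sL hL]]].
  exists [::]; split => //; rewrite mul0r big1// => x _.
  by rewrite /excess big_nil maxxx expr0n.
have w0 x : 0 <= excess L x by rewrite /excess le_max lexx.
have [j hj] := response w0.
exists (j :: L); split; first by rewrite /= sL.
apply: (le_trans (ler_sum _ (fun x _ => excess_sqr_cons j L x))).
rewrite !big_split/= -mulr_sumr -(natr1 t) mulrDl mul1r.
by lra.
Qed.

Lemma finite_game_average : exists L : seq J, L <> [::] /\
  forall x, x \in I -> \sum_(j <- L) g j x <= (size L)%:R.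
Proof.
set C := \sum_(x <- I) B x ^+ 2.
have C0 : 0 <= C by apply: sumr_ge0 => x _; exact: sqr_ge0.
(* With more than [C] plays the squared excesses sum to at most [n * C <= n ^+ 2], so each excess is
   at most [n]. An average regret of 1 suffices, since the additive constant absorbs it. *)
have [L [sL hL]] := slow_excess_growth (Num.truncn C).+1.
exists L; split; first by move=> L0; rewrite L0 in sL.
move=> x xI; set n := (size L)%:R : R.
have Cn : C <= n by rewrite /n sL ltW// truncnS_gt.
have hx : excess L x ^+ 2 <= n ^+ 2.
  apply: (@le_trans _ _ (\sum_(x <- I) excess L x ^+ 2)).
    rewrite (big_rem x)//= lerDl sumr_ge0// => y _; exact: sqr_ge0.
  by apply: (le_trans hL); rewrite -sL -/C expr2 ler_wpM2l.
have e0 : 0 <= excess L x by rewrite /excess le_max lexx.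
move: hx; rewrite ler_sqr ?nnegrE// ?ler0n// => hx.
by apply: le_trans hx; rewrite /excess le_max lexx orbT.
Qed.

End FiniteGame.

(** * Finite output histories as words over a finite alphabet *)

Section Words.
Set Implicit Arguments.
Unset Strict Implicit.
Local Open Scope ring_scope.

(* Outputs are listed most recent first, so that extending a history is a
   [cons]. *)
Fixpoint history (c : nat -> nat) k : seq nat :=
  if k is k'.+1 then c k' :: history c k' else [::].

Fixpoint words N k : seq (seq nat) :=
  if k is k'.+1 then [seq y :: v | v <- words N k', y <- iota 0 N] else [:: [::]].

Lemma size_history c k : size (history c k) = k.
Proof. by elim: k => //= k ->. Qed.

Lemma nth_rev_history c k i : (i < k)%N -> nth 0%N (rev (history c k)) i = c i.
Proof.
elim: k => //= k IH; rewrite ltnS leq_eqVlt rev_cons nth_rcons size_rev size_history.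
by case: (ltngtP i k) => //= [ik _|-> //]; exact: IH.
Qed.

Lemma words_uniq N k : uniq (words N k).
Proof.
elim: k => //= k IH; apply: allpairs_uniq => //; first exact: iota_uniq.
by move=> [v y] [v' y'] _ _ /= [-> ->].
Qed.

Lemma mem_words N k v : (v \in words N k) = (size v == k) && all (fun y => y < N)%N v.
Proof.
elim: k v => [|k IH] [|y v] //=.
  by apply/negbTE/negP => /allpairsP[[u z] /= [_ _]].
apply/allpairsP/idP => [[[u z] /= [uw + [-> ->]]]|].
  by rewrite mem_iota add0n /= => ->; move: uw; rewrite IH eqSS.
rewrite eqSS => /and3P[sv yN va]; exists (v, y); split => //=.
  by rewrite IH sv.
by rewrite mem_iota.
Qed.

Lemma history_words N c k : (forall i, c i < N)%N -> history c k \in words N k.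
Proof.
by move=> cN; rewrite mem_words size_history eqxx /=; elim: k => //= k ->; rewrite cN.
Qed.

Lemma sum_words_history (R : nzRingType) N c k (f : seq nat -> R) :
  (forall i, c i < N)%N ->
  \sum_(v <- words N k) (history c k == v)%:R * f v = f (history c k).
Proof.
move=> cN; rewrite (bigD1_seq (history c k)) ?words_uniq ?history_words//=.
rewrite eqxx mul1r big1 ?addr0// => v /negbTE; rewrite eq_sym => ->; exact: mul0r.
Qed.

End Words.

(** * Ultrafilter limits of empirical laws on cylinders *)

Section LimitLaw.
Set Implicit Arguments.
Unset Strict Implicit.
Local Open Scope ring_scope.
Local Open Scope classical_set_scope.
Context (R : realType) (J : Type) (N : nat).
Variables (c : J -> nat -> nat) (L : nat -> seq J).
Hypothesis cN : forall j i, (c j i < N)%N.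
Hypothesis L_neq0 : forall n, L n <> [::].

Let freq n v : R :=
  (\sum_(j <- L n) (history (c j) (size v) == v)%:R) / (size (L n))%:R.

Let size_gt0 n : 0 < (size (L n))%:R :> R.
Proof. by rewrite ltr0n; move: (@L_neq0 n); case: (L n). Qed.

Let freq_ge0 n v : 0 <= freq n v.
Proof. by apply: divr_ge0; rewrite ?ler0n// sumr_ge0// => j _; rewrite ler0n. Qed.

Let freq_le1 n v : freq n v <= 1.
Proof.
rewrite /freq ler_pdivrMr// mul1r -(sum1_size (L n)) natr_sum.
by apply: ler_sum => j _; rewrite lern1 leq_b1.
Qed.

Let freq_nil n : freq n [::] = 1.
Proof.
rewrite /freq (eq_bigr (fun=> 1%N%:R)) => [|j _]; last by rewrite eqxx.
by rewrite -natr_sum sum1_size divff// gt_eqF.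
Qed.

Let freq_split n v : freq n v = \sum_(y < N) freq n (nat_of_ord y :: v).
Proof.
rewrite /freq -mulr_suml exchange_big/=; congr (_ / _).
apply: eq_bigr => j _ /=.
rewrite (bigD1 (Ordinal (cN j (size v))))//= eqseq_cons eqxx/= big1 ?addr0// => y.
by rewrite eqseq_cons [c j _ == _]eq_sym -val_eqE/= => /negbTE ->.
Qed.

Let freq_sum n k f : \sum_(v <- words N k) freq n v * f v =
  (\sum_(j <- L n) f (history (c j) k)) / (size (L n))%:R.
Proof.
under [in RHS]eq_bigr => j _ do rewrite -(sum_words_history k f (cN j)).
rewrite exchange_big/= mulr_suml; apply: eq_big_seq => v.
rewrite mem_words => /andP[/eqP <- _].
by rewrite /freq -mulr_suml mulrAC.
Qed.

(** [m v] is the limit of [freq n v]. The finite identities and the eventual inequalities pass to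
    the limit; a word that no [j] produces has frequency zero throughout, which gives the support
    property. *)
Lemma limit_law : exists m : seq nat -> R,
  [/\ forall v, 0 <= m v, m [::] = 1,
      forall v, m v = \sum_(y < N) m (nat_of_ord y :: v),
      forall v, m v != 0 -> exists j, history (c j) (size v) = v &
      forall k f b,
        (\forall n \near \oo, \sum_(j <- L n) f (history (c j) k) <=
          b * (size (L n))%:R) ->
        \sum_(v <- words N k) m v * f v <= b].
Proof.
(* One ultrafilter refining [\oo] makes the frequencies of all words converge at once, by
   compactness of the unit interval. *)
have [U [UU ooU]] := ultraFilterLemma eventually_filter.
have cv v : exists l : R, freq n v @[n --> U] --> l.
  have := @segment_compact R 0 1; rewrite compact_ultra => /(_ (freq n v @[n --> U])).
  case.
  (* The image of [U] is maximal: if [A] is in a larger proper filter, the preimage of its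
     complement cannot belong to [U]. *)
  - split=> [|G PG UG]; first exact: fmap_proper_filter.
    rewrite predeqE => A; split=> [GA|]; last exact: UG.
    have [//|UnA] := in_ultra_setVsetC (freq^~ v @^-1` A) UU.
    have GnA : G (~` A) by exact: UG.
    by have [x []] := filter_ex (filterI GA GnA).
  - have freq01 n : `[0%R, 1%R]%classic (freq n v).
      rewrite /= in_itv/=.
      by apply/andP; split; [exact: freq_ge0|exact: freq_le1].
    exact: filterE freq01.
  by move=> l [_ hl]; exists l.
have {cv}[m mcv] := choice cv.
have UP : ProperFilter U by exact: ultra_proper.
have mU v (l : R) : freq n v @[n --> U] --> l -> m v = l.
  by move=> h; exact: (cvg_unique (@norm_hausdorff _ R^o) (mcv v) h).
exists m; split.
- move=> v; apply: (cvgr_to_ge (mcv v)); exact: nearW.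
- apply: mU; under eq_fun do rewrite freq_nil; exact: cvg_cst.
- move=> v; apply: mU; under eq_fun do rewrite freq_split.
  by apply: cvg_big => //=; exact: add_continuous.
- move=> v; apply: contra_neqP => nj; apply: mU.
  rewrite (_ : (fun n => _) = fun=> 0); first exact: cvg_cst.
  apply/funext => n; rewrite /freq big1 ?mul0r// => j _.
  by case: eqP => // hj; case: nj; exists j.
move=> k f b hb.
have : \sum_(v <- words N k) freq n v * f v @[n --> U] -->
       \sum_(v <- words N k) m v * f v.
  by apply: cvg_big => [|v _]; [exact: add_continuous | exact: cvgMl].
move=> hs; apply: (cvgr_to_le hs).
apply: ooU; apply: filterS hb => n hn.
by rewrite freq_sum ler_pdivrMr.
Qed.

End LimitLaw.

(** * Realization of a consistent family of cylinder masses on the unit interval *)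

Section NestedIntervals.
Set Implicit Arguments.
Unset Strict Implicit.
Local Open Scope ring_scope.
Local Open Scope classical_set_scope.
Context (R : realType) (N : nat) (m : seq nat -> R).
Hypothesis m_ge0 : forall v, 0 <= m v.
Hypothesis m_nil : m [::] = 1.
Hypothesis m_split : forall v, m v = \sum_(y < N) m (nat_of_ord y :: v).

(** The children of a word are laid side by side from the left end of its interval; by [m_split] the
    [N] of them fill it exactly. *)
Fixpoint cell_left (v : seq nat) : R :=
  if v is y :: v' then cell_left v' + \sum_(x < y) m (nat_of_ord x :: v') else 0.

Let cell v : set R := `[cell_left v, cell_left v + m v[.

Let cellE v w : cell v w = (cell_left v <= w < cell_left v + m v) :> Prop.
Proof. by rewrite /cell /= in_itv. Qed.

Let sum_le v a b : (a <= b)%N ->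
  \sum_(x < a) m (nat_of_ord x :: v) <= \sum_(x < b) m (nat_of_ord x :: v).
Proof.
move=> ab; rewrite -!(big_mkord predT (fun x => m (x :: v))).
by rewrite (big_cat_nat (leq0n a) ab)/= lerDl sumr_ge0.
Qed.

Let sum_recr v y : \sum_(x < y) m (nat_of_ord x :: v) + m (y :: v) =
  \sum_(x < y.+1) m (nat_of_ord x :: v).
Proof. by rewrite big_ord_recr. Qed.

Let cell_sub y v w : (y < N)%N -> cell (y :: v) w -> cell v w.
Proof.
rewrite !cellE /= => yN /andP[h1 h2]; apply/andP; split.
  by apply: le_trans h1; rewrite lerDl sumr_ge0.
apply: (lt_le_trans h2); rewrite -addrA lerD2l (m_split v).
by rewrite sum_recr; exact: sum_le.
Qed.

Let cell_step v w : cell v w -> exists y, (y < N)%N /\ cell (y :: v) w.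
Proof.
rewrite cellE m_split => /andP[hl]; elim: N => [|n IH].
  by rewrite big_ord0 addr0 ltNge hl.
rewrite big_ord_recr/= addrA => hr.
case: (ltP w (cell_left v + \sum_(i < n) m (nat_of_ord i :: v))) => [/IH[y [yn yc]]|h].
  by exists y; split => //; exact: ltnW.
by exists n; split => //; rewrite cellE/= h.
Qed.

Let cell_inj u v w : size u = size v ->
  all (fun y => y < N)%N u -> all (fun y => y < N)%N v ->
  cell u w -> cell v w -> u = v.
Proof.
elim: u v => [|y u IH] [|z v]//= [suv] /andP[yN uN] /andP[zN vN] cu cv.
have {IH}uv : u = v by apply: IH => //; [exact: cell_sub cu|exact: cell_sub cv].
subst v; congr (_ :: _).
have aux a b : cell (a :: u) w -> cell (b :: u) w -> (a < b)%N -> False.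
  rewrite !cellE/= => /andP[_ h1] /andP[h2 _] ab.
  suff h : cell_left u + \sum_(x < a) m (nat_of_ord x :: u) + m (a :: u) <= w.
    by have := lt_le_trans h1 h; rewrite ltxx.
  apply: le_trans h2; rewrite -addrA lerD2l.
  by rewrite sum_recr; exact: sum_le.
by case: (ltngtP y z) => // /aux; [move/(_ cu cv)|move/(_ cv cu)].
Qed.

Let unit_cell w : (`[0, 1[%classic w) = cell [::] w.
Proof. by rewrite cellE/= in_itv/= m_nil add0r. Qed.

Let cell_unit v : all (fun y => y < N)%N v -> cell v `<=` `[0, 1[.
Proof.
move=> vN w; rewrite unit_cell; elim: v vN => //= y v IH /andP[yN vN] /(cell_sub yN).
exact: IH.
Qed.

Let prob := uniform_prob (@ltr01 R).

Let prob_cell v : all (fun y => y < N)%N v -> prob (cell v) = (m v)%:E.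
Proof.
move=> vN; rewrite /prob /uniform_prob.
rewrite (eq_integral (fun=> 1%:E)); last first.
  move=> w; rewrite inE => /(cell_unit vN); rewrite /= in_itv/= => /andP[w0 w1].
  by rewrite /uniform_pdf w0 (ltW w1) subr0 invr1.
rewrite integral_cst/= ?mul1e; last exact: measurable_itv.
rewrite lebesgue_measure_itv/= lte_fin ltrDl -EFinB addrAC subrr add0r.
(* The remaining case is an empty interval, where the mass is zero. *)
by case: ltP => // h; congr EFin; apply: le_anti; rewrite m_ge0 h.
Qed.

(** A point reads off the letters of the nested cells that contain it. These half-open cells are
    nonempty, so every history read has positive mass. *)
Lemma cylinder_realization : exists A : R -> nat -> nat,
  [/\ forall w k, history (A w) k \in words N k,
      forall w k, m (history (A w) k) != 0,
      forall k v, v \in words N k ->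
        measurable ([set w | history (A w) k = v] : set (measurableTypeR R)) &
      forall k v, v \in words N k ->
        prob [set w | history (A w) k = v] = (m v)%:E].
Proof.
have step p : exists y, cell p.2 p.1 -> (y < N)%N /\ cell (y :: p.2) p.1.
  have [/cell_step[y]|] := pselect (cell p.2 p.1); first by exists y.
  by exists 0%N.
have [digit digitP] := choice step.
(* Points outside [[0, 1)] form a null set but must still yield histories
   of positive mass, since feasibility is required everywhere. *)
pose clamp (w : R) := if 0 <= w < 1 then w else 0.
have clampP w : cell [::] (clamp w).
  rewrite -unit_cell /clamp /= in_itv/=; case: ifP => [//|_].
  by rewrite lexx ltr01.
pose pre w := fix pre k := if k is k'.+1 then digit (w, pre k') :: pre k' else [::].
pose A w k := digit (clamp w, pre (clamp w) k).
have histE w k : history (A w) k = pre (clamp w) k by elim: k => //= k ->.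
have preP w k : cell (pre (clamp w) k) (clamp w) /\ pre (clamp w) k \in words N k.
  elim: k => [|k [IH1 IH2]]; first by split=> //; rewrite inE.
  have [d1 d2] := digitP (clamp w, pre (clamp w) k) IH1.
  split=> //; move: IH2; rewrite !mem_words/= eqSS => /andP[-> ->].
  by rewrite d1.
(* All points outside [[0, 1[] behave like 0, so they join the cylinder exactly when its cell
   contains 0. *)
have setE k v : v \in words N k -> [set w | history (A w) k = v] =
    cell v `|` (if pselect (cell v 0) then ~` `[0, 1[ else set0).
  rewrite mem_words => /andP[/eqP sv vN]; apply/seteqP; split=> w /=.
    rewrite histE => hv; have [h _] := preP w k; rewrite hv in h.
    move: h; rewrite /clamp; case: ifPn => [_|nw] h; first by left.
    right; case: pselect => //= _; rewrite in_itv; exact/negP.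
  have eqv : cell v (clamp w) -> history (A w) k = v.
    move=> h; have [h' hw] := preP w k; rewrite histE.
    move: hw; rewrite mem_words => /andP[/eqP sw wN].
    by apply: cell_inj h' h => //; rewrite sw.
  case=> [h|].
    by apply: eqv; move: (cell_unit vN h); rewrite /clamp /= in_itv/= => ->.
  case: pselect => //= h; rewrite in_itv/= => nw.
  by apply: eqv; rewrite /clamp ifF//; exact/negbTE/negP.
have mcell v : measurable (cell v : set (measurableTypeR R)) by exact: measurable_itv.
have mrest (v : seq nat) : measurable ((if pselect (cell v 0) then ~` `[0, 1[ else set0)
     : set (measurableTypeR R)).
  case: pselect => h /=; last exact: measurable0.
  by apply: measurableC; exact: measurable_itv.
exists A; split.
- by move=> w k; rewrite histE; have [] := preP w k.
- move=> w k; rewrite histE; have [] := preP w k; rewrite cellE => /andP[h1 h2] _.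
  by apply: contraTneq (le_lt_trans h1 h2) => ->; rewrite addr0 ltxx.
- by move=> k v vk; rewrite (setE _ _ vk); exact: measurableU.
move=> k v vk; rewrite (setE _ _ vk).
move: vk; rewrite mem_words => /andP[_ vN].
rewrite /prob measureU//.
  transitivity ((m v)%:E + 0)%E; last by rewrite adde0.
  congr (_ + _)%E; first exact: prob_cell.
  (* The complement of [[0, 1[] is null, so the extra points do not change the mass. *)
  case: pselect => h /=; last exact: measure0.
  rewrite probability_setC; last exact: measurable_itv.
  have -> : `[0, 1[ = cell [::] by rewrite /cell /= m_nil add0r.
  have p1 : prob (cell [::]) = 1%:E by rewrite prob_cell ?m_nil.
  by rewrite [X in (_ - X)%E](p1 : _ = _) subee.
apply/seteqP; split=> w //= [/(cell_unit vN) cw].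
by case: pselect.
Qed.

End NestedIntervals.

(** * Measurability and expectation for finitely valued random variables *)

Section FiniteValued.
Set Implicit Arguments.
Unset Strict Implicit.
Local Open Scope ring_scope.
Local Open Scope classical_set_scope.
Context (R : realType) (dd : measure_display) (Om : measurableType dd)
  (P : {measure set Om -> \bar R}) (V : eqType) (s : seq V) (X : Om -> V).
Hypothesis Xs : forall w, X w \in s.
Hypothesis mX : forall v, v \in s -> measurable [set w | X w = v].

Lemma measurable_finite_valued (phi : V -> Prop) : measurable [set w | phi (X w)].
Proof.
rewrite (_ : [set w | _] =
    \bigcup_(v in [set v | v \in s /\ phi v]) [set w | X w = v]); last first.
  by apply/seteqP; split=> [w Pw|w [v [_ Pv] /= ->]//]; exists (X w).
apply: fin_bigcup_measurable => [|v [vs _]]; last exact: mX.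
by apply: sub_finite_set (finite_seq s) => v [].
Qed.

Lemma integral_finite_valued (p f : V -> R) : uniq s -> (forall v, 0 <= f v) ->
  (forall v, v \in s -> P [set w | X w = v] = (p v)%:E) ->
  (\int[P]_w (f (X w))%:E = (\sum_(v <- s) p v * f v)%:E)%E.
Proof.
move=> us f0 Pp.
pose h v (w : Om) : \bar R := ((f v)%:E * (\1_[set w | X w = v] w)%:E)%E.
have mev v : measurable [set w | X w = v].
  exact: (measurable_finite_valued (fun u => u = v)).
have mind v : measurable_fun setT (EFin \o (\1_[set w | X w = v] : Om -> R)).
  by apply/measurable_EFinP; exact: measurable_indic.
rewrite (eq_integral (fun w => \sum_(v <- s) h v w)%E); last first.
  move=> w _; rewrite (bigD1_seq (X w))//= big1 ?adde0.
    by rewrite /h indicE mem_set//= mule1.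
  move=> v vX; rewrite /h indicE memNset ?mule0//= => Xv; by rewrite Xv eqxx in vX.
rewrite ge0_integral_sum//; last 2 first.
- by move=> v; apply: measurable_funeM; exact: mind.
- by move=> v w _; rewrite /h -EFinM lee_fin mulr_ge0.
rewrite -sumEFin; apply: eq_big_seq => v vs.
rewrite /h ge0_integralZl_EFin//; last exact: mind.
by rewrite integral_indic// setIT Pp// -EFinM mulrC.
Qed.

End FiniteValued.

(** * Finiteness of costs and coding of algorithms by sequences of numbers *)

Section Costs.
Set Implicit Arguments.
Unset Strict Implicit.
Local Open Scope ring_scope.
Local Open Scope classical_set_scope.
Context (R : realType) (S T : finType) (task : T -> S -> \bar R) (d : S -> S -> R).
Hypothesis task_ge0 : forall t s, (0 <= task t s)%E.
Hypothesis task_proper : forall t, exists s, task t s != +oo%E.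
Hypothesis d_ge0 : forall s s', 0 <= d s s'.

Lemma path_cost_ge0 s ts ss : (0 <= path_cost task d s ts ss)%E.
Proof.
elim: ts s ss => [|t ts IH] s [|s' ss]//=.
by rewrite !adde_ge0// lee_fin.
Qed.

Lemma alg_cost_ge0 (D : det_alg S T) s0 ts : (0 <= alg_cost task d D s0 ts)%E.
Proof. exact: path_cost_ge0. Qed.

Lemma alg_cost_fin (D : det_alg S T) s0 ts : feasible task D ->
  alg_cost task d D s0 ts \is a fin_num.
Proof.
move=> fD; rewrite /alg_cost /run.
have : forall us t, task t (D s0 (rcons us t)) != +oo%E by exact: fD.
move: (D s0) => F; elim: ts F {1}s0 => [|t ts IH] F s fF //=.
(* After the first round the run continues as that of the algorithm with [t] prepended to its
   past. *)
have := IH (fun us => F (t :: us)) (F [:: t]) (fun us => fF (t :: us)).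
rewrite take0 -[1%N]/(1 + 0)%N iotaDl -map_comp fin_numD => -> /=.
rewrite andbT fin_numD /= ge0_fin_numE ?ltey//.
exact: (fF [::] t).
Qed.

Lemma exists_feasible : exists D : det_alg S T, feasible task D.
Proof.
have [best bestP] := choice task_proper.
exists (fun s0 ts => if rev ts is t :: _ then best t else s0) => s0 ts t.
by rewrite rev_rcons.
Qed.

Lemma OPT_fin s0 ts : OPT task d s0 ts \is a fin_num.
Proof.
have [D fD] := exists_feasible.
rewrite ge0_fin_numE; last first.
  by apply: le_ereal_inf_tmp => _ [ss _ <-]; exact: path_cost_ge0.
apply: (@le_lt_trans _ _ (alg_cost task d D s0 ts)).
  apply: ereal_inf_lbound; exists (run D s0 ts) => //=.
  by rewrite size_map size_iota.
by rewrite -ge0_fin_numE ?alg_cost_fin// alg_cost_ge0.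
Qed.

(** The cost depends on [D] only through one of finitely many output tuples, so the sum over all
    tuples dominates; [fine] turns infinite costs into 0. This bounds the regrets uniformly. *)
Lemma alg_cost_bound s0 ts : exists b : R, forall D : det_alg S T,
  fine (alg_cost task d D s0 ts) <= b.
Proof.
exists (\sum_(ss : (size ts).-tuple S) fine (path_cost task d s0 ts ss)) => D.
have sr : size (run D s0 ts) == size ts by rewrite size_map size_iota.
rewrite (bigD1 (Tuple sr))//= lerDl sumr_ge0// => ss _.
by rewrite fine_ge0// path_cost_ge0.
Qed.

Lemma eq_alg_cost (D D' : det_alg S T) s0 ts :
  (forall i, (i < size ts)%N -> D s0 (take i.+1 ts) = D' s0 (take i.+1 ts)) ->
  alg_cost task d D s0 ts = alg_cost task d D' s0 ts.
Proof.
move=> h; rewrite /alg_cost; congr path_cost.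
by apply/eq_in_map => i; rewrite mem_iota => /h.
Qed.

(** The countably many pairs of initial state and task prefix are numbered by [pickle], so an
    algorithm becomes one sequence over a finite alphabet. *)
Definition encode (D : det_alg S T) (k : nat) : nat :=
  if (unpickle k : option (S * seq T)) is Some (s0, ts)
  then index (D s0 ts) (enum S) else 0.

Definition decode (c : nat -> nat) : det_alg S T :=
  fun s0 ts => nth s0 (enum S) (c (pickle (s0, ts))).

(** The successor leaves room for the default letter 0 even when [S] is empty. *)
Lemma encode_lt D k : (encode D k < #|S|.+1)%N.
Proof.
by rewrite /encode; case: unpickle => // -[s0 ts]; rewrite ltnS cardE index_size.
Qed.

Lemma decode_eq c D s0 ts : c (pickle (s0, ts)) = encode D (pickle (s0, ts)) ->
  decode c s0 ts = D s0 ts.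
Proof. by rewrite /decode /encode pickleK => ->; rewrite nth_index// mem_enum. Qed.

(** A run on [ts] consults only its nonempty prefixes; [k] exceeds all their codes. *)
Lemma alg_cost_decode_history s0 ts : exists k, forall c,
  alg_cost task d (decode c) s0 ts =
  alg_cost task d (decode (nth 0%N (rev (history c k)))) s0 ts.
Proof.
exists (\max_(i < size ts) pickle (s0, take i.+1 ts)).+1 => c.
apply: eq_alg_cost => i its; rewrite /decode nth_rev_history//.
by rewrite ltnS (leq_bigmax (Ordinal its)).
Qed.

End Costs.

(** * From best responses to a competitive randomized algorithm *)

Theorem theorem6 (R : realType) (S T : finType) (task : T -> S -> \bar R)
  (d : S -> S -> R) :
  lazy_task_system task d -> compact_problem task d.
Proof.
move=> [[_ [task_ge0 [task_proper d_ge0]]] _] c _ hard eps alpha eps_gt0 _.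
apply: contrapT => no_dist.
pose J := {D : det_alg S T | feasible task D}.
have [D0 D0f] := exists_feasible task_proper.
pose o (x : S * seq T) : R := fine (OPT task d x.1 x.2).
pose cost (j : J) (x : S * seq T) : R := fine (alg_cost task d (sval j) x.1 x.2).
have oE x : OPT task d x.1 x.2 = (o x)%:E by rewrite fineK// OPT_fin.
have costE (j : J) x : alg_cost task d (sval j) x.1 x.2 = (cost j x)%:E.
  by rewrite fineK// alg_cost_fin//; exact: svalP.
pose g j x := (cost j x - ((c - eps) * o x + alpha))%R.
have [b bP] : exists b : S * seq T -> R, forall x j, (`|g j x| <= b x)%R.
  suff /choice[b bP] : forall x, exists b : R, forall j, (`|g j x| <= b)%R by exists b.
  move=> x; have [b bP] := alg_cost_bound task_ge0 d_ge0 x.1 x.2.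
  exists (b + `|(c - eps) * o x + alpha|)%R => j; rewrite /g.
  apply: (le_trans (ler_normB _ _)); rewrite lerD2r.
  by rewrite ger0_norm ?bP// fine_ge0// alg_cost_ge0.
have response I (w : S * seq T -> R) : (forall x, 0 <= w x)%R ->
    exists j, (\sum_(x <- I) w x * g j x <= 0)%R.
  move=> w0; pose W := (\sum_(x <- I) w x)%R.
  have W_ge0 : (0 <= W)%R by exact: sumr_ge0.
  (* Zero weights cannot be normalized, but then any feasible algorithm responds. *)
  have [W0|Wn0] := eqVneq W 0%R.
    exists (exist _ D0 D0f); rewrite big_seq big1// => x xI.
    move: W0 => /eqP; rewrite psumr_eq0// => /allP/(_ x xI)/eqP ->.
    by rewrite mul0r.
  have Wgt0 : (0 < W)%R by rewrite lt_neqAle eq_sym Wn0.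
  pose p := [seq (x, (w x / W)%R) | x <- I].
  have pd : input_dist p.
    split=> [_ /mapP[x _ ->]/=|]; first exact: divr_ge0.
    by rewrite big_map/= -mulr_suml divff.
  have [D fD D_bad] : exists2 D, feasible task D &
      ~ ((c - eps)%:E * expect p (OPT task d) + alpha%:E
           <= expect p (alg_cost task d D))%E.
    apply: contrapT => h; apply: no_dist; exists p; split=> // D fD.
    by apply: contrapT => hD; apply: h; exists D.
  exists (exist _ D fD); move/negP: D_bad.
  set j : J := exist _ D fD.
  have -> : expect p (OPT task d) = (\sum_(x <- I) w x / W * o x)%R%:E.
    rewrite /expect big_map/= -sumEFin; apply: eq_bigr => x _.
    by rewrite oE -EFinM.
  have -> : expect p (alg_cost task d D) = (\sum_(x <- I) w x / W * cost j x)%R%:E.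
    rewrite /expect big_map/= -sumEFin; apply: eq_bigr => x _.
    by rewrite (costE j) -EFinM.
  rewrite -EFinM -EFinD lee_fin -ltNge => h.
  suff : ((\sum_(x <- I) w x * g j x) / W <= 0)%R.
    by rewrite pmulr_lle0// invr_gt0.
  have -> : ((\sum_(x <- I) w x * g j x) / W = \sum_(x <- I) w x / W * cost j x -
     ((c - eps) * (\sum_(x <- I) w x / W * o x) + alpha * (\sum_(x <- I) w x / W)))%R.
    rewrite !mulr_sumr -big_split -sumrB mulr_suml; apply: eq_bigr => x _.
    by rewrite /g /=; ring.
  by rewrite -mulr_suml divff// mulr1 subr_le0 ltW.
pose inputs n : seq (S * seq T) := pmap unpickle (iota 0 n).
(* [L n] is a list of feasible algorithms whose average regret is at most 1 on each of the first [n]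
   inputs. *)
have [L LP] := choice (fun n =>
  finite_game_average (fun j x => bP x j) (response (inputs n))).
have L_neq0 n : L n <> [::] by have [] := LP n.
have [m [m_ge0 m_nil m_split m_supp m_avg]] :=
  limit_law R (fun j : J => encode_lt (sval j)) L_neq0.
have [A [Awords Asupp mA PA]] := cylinder_realization m_ge0 m_nil m_split.
apply: (hard _ _ (uniform_prob (@ltr01 R)) (fun w => decode (A w)) _ (c - eps)%R).
- split=> [w s0 ts t|s0 ts s].
    (* A history of positive mass comes from a feasible algorithm [j]. The successor makes it long
       enough to contain the answer at this very code, which is thus feasible. *)
    have [j hj] := m_supp _ (Asupp w (pickle (s0, rcons ts t)).+1).
    rewrite (@decode_eq _ _ _ (sval j)); first exact: (svalP j).
    move: hj; rewrite size_history => hj.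
    by rewrite -(nth_rev_history (A w) (ltnSn _)) -hj nth_rev_history.
  pose k := (pickle (s0, ts)).+1.
  pose out v := nth s0 (enum S) (nth 0%N (rev v) (pickle (s0, ts))).
  rewrite (_ : [set w | _]%classic = [set w | out (history (A w) k) = s]%classic).
    exact: (measurable_finite_valued (fun w => Awords w k) (mA k) (fun v => out v = s)).
  by apply/funext => w; rewrite /mkset /out nth_rev_history.
- by rewrite ltrBlDr ltrDl.
(* The extra 1 is the average regret left by the finite games. *)
exists (alpha + 1)%R => s0 ts.
have [k hk] := alg_cost_decode_history task d s0 ts.
pose f v : R := fine (alg_cost task d (decode (nth 0%N (rev v))) s0 ts).
have histj (j : J) : f (history (encode (sval j)) k) = cost j (s0, ts).
  rewrite /f -hk; congr fine; apply: eq_alg_cost => i _; exact: decode_eq.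
(* The cost is finite because up to [k] the outputs agree with those of a feasible algorithm. *)
have fA w : alg_cost task d (decode (A w)) s0 ts = (f (history (A w) k))%:E.
  have [j hj] := m_supp _ (Asupp w k); rewrite size_history in hj.
  by rewrite hk -hj histj -costE -hk; apply: eq_alg_cost => i _; exact: decode_eq.
under eq_integral do rewrite fA.
rewrite (integral_finite_valued (P := uniform_prob (@ltr01 R)) (p := m) (f := f)
  (fun w => Awords w k) (mA k) (words_uniq _ k) _ (PA k)); last first.
  by move=> v; rewrite fine_ge0// alg_cost_ge0.
rewrite (oE (s0, ts)) -EFinM -EFinD lee_fin.
(* Once [n] exceeds its code, the input is among those controlled by [L n]. *)
apply: m_avg; exists (pickle (s0, ts)).+1 => // n /= hn.
have xI : (s0, ts) \in inputs n.
  rewrite mem_pmap; apply/mapP; exists (pickle (s0, ts)); rewrite ?pickleK//.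
  by rewrite mem_iota.
have [_ /(_ _ xI)] := LP n.
rewrite (eq_bigr (fun j => cost j (s0, ts))) => [|j _]; last exact: histj.
rewrite /g sumrB big_const_seq count_predT iter_addr_0 lerBlDr => h.
by apply: (le_trans h); rewrite -[X in (_ + X)%R]mulr_natr; lra.
Qed.
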